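(* Fix $b,h>0$, $\lambda$ and $M$, with $\lambda<M$. For any policy $\pi$ with access to $N$ censored demand samples (each $\min\{d_i,\lambda\}$ with $d_1,\dots,d_N$ i.i.d. from $G$), which maps these samples to an ordering quantity $q^\pi\in[0,M]$: (i) in the strictly identifiable regime, $$\sup_{G\in\mathcal G^{\mathrm{id}}}\mathbb E_G\big[\mathrm{Regret}(q^\pi)-\Delta\big]\ \ge\ \frac{\lambda(b+h)\sqrt{1-\rho}\,\min\{\rho,1-\rho\}\,e^{-1/2}}{64\sqrt N};$$ (ii) in the knife-edge regime, $$\sup_{G\in\mathcal G^{\mathrm{ke}}}\mathbb E_G\big[\mathrm{Regret}(q^\pi)-\Delta\big]\ \ge\ \frac{\lambda(b+h)\sqrt{1-\rho}\,\min\{\rho,1-\rho\}\,e^{-1/2}}{32\sqrt N};$$ (iii) in the strictly unidentifiable regime, $$\sup_{G\in\mathcal G^{\mathrm{ui}}}\mathbb E_G\big[\mathrm{Regret}(q^\pi)-\Delta\big]\ \ge\ \frac{h(M-\lambda)\sqrt{1-\rho}\,\min\{\rho,1-\rho\}\min\{\rho,3\rho-1\}\,e^{-1/2}}{64\sqrt N}.$$ Here $\mathrm{Regret}$ and $\Delta$ are those associated with $G$ (and $\lambda$), and the expectation is over the samples drawn from $G$.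
   Context: Given costs $b,h>0$, let $\rho=\frac{b}{b+h}\in(0,1)$. The constant $\lambda\ge 0$ (the observable boundary) is the largest historical ordering quantity, and $M$ is a known finite upper bound on the optimal ordering quantity. For a cdf $F$ of a nonnegative random variable $D$ (demand) with $\mathbb E_F[D]<\infty$ and $q\ge 0$, the newsvendor cost is $C_F(q)=\mathbb E_F[b(D-q)^+ + h(q-D)^+]$, and $q^\star_F=\inf\{q : F(q)\ge\rho\}$. Let $\mathcal G=\{F : F \text{ has nonnegative support},\ \mathbb E_F[D]<\infty,\ q^\star_F\le M\}$. For $G\in\mathcal G$: $G^-(\lambda)=\mathbb P_G(D<\lambda)$; $\mathcal F(\lambda;G)=\{F\in\mathcal G : F(x)=G(x)\ \forall x<\lambda\}$; $\mathrm{Regret}(q)=\sup_{F\in\mathcal F(\lambda;G)}\{C_F(q)-C_F(q^\star_F)\}$; $\Delta=\inf_{q\in[0,M]}\mathrm{Regret}(q)$ (both depend on $G$). Identifiability regimes: $\mathcal G^{\mathrm{id}}$ is the set of $G\in\mathcal G$ with $G^-(\lambda)>\rho+\frac{c}{\sqrt N}$ for some $c>0$; $\mathcal G^{\mathrm{ke}}$ is the set of $G\in\mathcal G$ with $|G^-(\lambda)-\rho|\le\frac{c}{\sqrt N}$ for some $c>0$; $\mathcal G^{\mathrm{ui}}$ is the set of $G\in\mathcal G$ with $G^-(\lambda)<\rho-\frac{c}{\sqrt N}$ for some $c>0$.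
   Formalization: The case λ = 0 is excluded (λ > 0 is assumed): there Regret does not depend on G, so a constant policy has zero excess and (iii) fails when ρ > 1/3, while the strictly identifiable class in (i) is empty. *)

(* Defs.v *)
From HB Require Import structures.
From mathcomp Require Import all_boot all_order all_algebra.
From mathcomp Require Import all_classical all_reals all_analysis.

Set Implicit Arguments.
Unset Strict Implicit.
Unset Printing Implicit Defensive.

Import Order.TTheory GRing.Theory Num.Theory.
Import numFieldNormedType.Exports.

Local Open Scope classical_set_scope.
Local Open Scope ring_scope.

Definition tuple_cons d (T : measurableType d) (n : nat)
  (x : T * n.-tuple T) : n.+1.-tuple T := [tuple of x.1 :: x.2].

Lemma measurable_tuple_cons d (T : measurableType d) (n : nat) :
  measurable_fun [set: T * n.-tuple T] (@tuple_cons d T n).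
Proof. exact: measurable_cons measurable_fst measurable_snd. Qed.

HB.instance Definition _ d (T : measurableType d) (n : nat) :=
  isMeasurableFun.Build _ _ _ _ (@tuple_cons d T n)
    (@measurable_tuple_cons d T n).

(* The n-fold product measure of G: the joint law of n i.i.d. draws from G. *)
Fixpoint iid_law d (T : measurableType d) (R : realType) (G : probability T R)
    (n : nat) : probability (n.-tuple T) R :=
  match n with
  | 0 => dirac [tuple]
  | m.+1 => distribution (G \x iid_law G m)%E (@tuple_cons d T m)
  end.

(* A demand distribution is represented by the law of D, a Borel probability
   on R, rather than by its cdf. *)
Definition law_cdf (R : realType) (F : probability R R) (x : R) : R :=
  fine (F `]-oo, x]%classic).

Definition critical_ratio (R : realType) (b h : R) : R := b / (b + h).

Definition newsvendor_cost (R : realType) (b h : R) (F : probability R R)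
    (q : R) : \bar R :=
  'E_F[(fun d => b * Num.max (d - q) 0 + h * Num.max (q - d) 0)%R]%E.

Definition qstar (R : realType) (b h : R) (F : probability R R) : R :=
  inf [set q | critical_ratio b h <= law_cdf F q].

Definition demand_class (R : realType) (b h M : R) : set (probability R R) :=
  [set F : probability R R |
    [/\ F `]-oo, 0[%classic = 0%E, ('E_F[idfun] < +oo)%E & qstar b h F <= M]].

Definition ambiguity_set (R : realType) (b h M lambda : R)
    (G : probability R R) : set (probability R R) :=
  [set F : probability R R | demand_class b h M F /\
           forall x, x < lambda -> law_cdf F x = law_cdf G x].

Definition regret (R : realType) (b h M lambda : R) (G : probability R R)
    (q : R) : \bar R :=
  ereal_sup [set (newsvendor_cost b h F q
                  - newsvendor_cost b h F (qstar b h F))%E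
            | F in ambiguity_set b h M lambda G].

Definition minimax_regret (R : realType) (b h M lambda : R)
    (G : probability R R) : \bar R :=
  ereal_inf [set regret b h M lambda G q | q in `[0, M]].

(* G^-(lambda) = P_G(D < lambda) *)
Definition cdf_left (R : realType) (G : probability R R) (lambda : R) : R :=
  fine (G `]-oo, lambda[%classic).

(* The three identifiability regimes at sample size N; c is the constant
   setting the width c / sqrt N of the knife-edge window around rho, so that
   for a given c and N the three sets partition the demand class. *)
Definition identifiable (R : realType) (b h M lambda c : R) (N : nat) :
    set (probability R R) :=
  [set G : probability R R | demand_class b h M G /\
           cdf_left G lambda > critical_ratio b h + c / Num.sqrt N%:R].

Definition knife_edge (R : realType) (b h M lambda c : R) (N : nat) :
    set (probability R R) :=
  [set G : probability R R | demand_class b h M G /\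
           `|cdf_left G lambda - critical_ratio b h| <= c / Num.sqrt N%:R].

Definition unidentifiable (R : realType) (b h M lambda c : R) (N : nat) :
    set (probability R R) :=
  [set G : probability R R | demand_class b h M G /\
           cdf_left G lambda < critical_ratio b h - c / Num.sqrt N%:R].

Definition policy (R : realType) (M : R) (N : nat) : set (N.-tuple R -> R) :=
  [set f : N.-tuple R -> R |
    measurable_fun [set: N.-tuple R] f /\ forall s, 0 <= f s <= M].

Definition censor (R : realType) (lambda : R) (N : nat) (d : N.-tuple R) :
  N.-tuple R := [tuple of map (fun x => Num.min x lambda) d].

(* E_G[Regret(q^f) - Delta], the demands d being i.i.d. from G and f seeing
   only the censored sample. *)
Definition expected_excess_regret (R : realType) (b h M lambda : R) (N : nat)
    (f : N.-tuple R -> R) (G : probability R R) : \bar R :=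
  (\int[iid_law G N]_d (regret b h M lambda G (f (censor lambda d))
                        - minimax_regret b h M lambda G))%E.

Definition worst_case_excess (R : realType) (b h M lambda : R) (N : nat)
    (f : N.-tuple R -> R) (S : set (probability R R)) : \bar R :=
  ereal_sup [set expected_excess_regret b h M lambda f G | G in S].

(* Main.v *)
(* Le Cam's method with demands G_p = p delta_0 + (1 - p) delta_x.  Two values
   p0 < p1 at distance O(1 / sqrt N) cannot be told apart from N draws, yet they
   call for different orders.  If p0 < rho < p1 then q = x is the target under
   G_p0 and q = 0 under G_p1; taking x = lambda / 2 puts both laws in the
   identifiable regime, x = lambda in the knife-edge one.  If p < rho and
   x = lambda, the binding members of the ambiguity set move the mass 1 - p to
   lambda or to M, so Regret(q) = max((b+h)(rho-p)(M-q), h(q-lambda)) for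
   lambda <= q <= M; its minimizer depends on p, and two values p0 < p1 below
   rho give the unidentifiable regime.  In all cases the excess regrets are at
   least mu (u0 - q)^+ and mu (q - u1)^+ with u1 < u0, so some law costs at least
   mu (u0 - u1) / 4. *)
From HB Require Import structures.
Require Import Defs.
From mathcomp Require Import all_boot all_order all_algebra.
From mathcomp Require Import all_classical all_reals all_analysis.
From mathcomp Require Import measurable_realfun ring lra.

Set Implicit Arguments.
Unset Strict Implicit.
Unset Printing Implicit Defensive.

Import Order.TTheory GRing.Theory Num.Theory.
Import numFieldNormedType.Exports.

Local Open Scope classical_set_scope.
Local Open Scope ring_scope.

(** * Two-point demands, their i.i.d. draws and Le Cam's bound *)

Definition zero_or (R : realType) (x : R) (z : bool) : R := if z then 0 else x.

Lemma measurable_zero_or (R : realType) (x : R) :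
  measurable_fun [set: bool] (zero_or x).
Proof. by []. Qed.

HB.instance Definition _ (R : realType) (x : R) :=
  isMeasurableFun.Build _ _ _ _ (zero_or x) (measurable_zero_or x).

(* p delta_0 + (1 - p) delta_x, for 0 <= p <= 1; bernoulli_prob p is delta_false
   otherwise *)
Definition two_point (R : realType) (p x : R) : probability R R :=
  distribution (bernoulli_prob p) (zero_or x).

Lemma integral_two_point (R : realType) (p x : R) (f : R -> \bar R) :
  0 <= p <= 1 -> measurable_fun setT f -> (forall t, 0 <= f t)%E ->
  (\int[two_point p x]_t f t = p%:E * f 0%R + (1 - p)%:E * f x)%E.
Proof.
move=> p01 mf f0.
by rewrite ge0_integral_distribution// integral_bernoulli_prob//= => z; exact: f0.
Qed.

Lemma two_pointE (R : realType) (p x : R) (A : set R) :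
  0 <= p <= 1 -> measurable A ->
  two_point p x A = (p * \1_A 0 + (1 - p) * \1_A x)%:E.
Proof.
move=> p01 mA; have -> : two_point p x A = (\int[two_point p x]_t (\1_A t)%:E)%E.
  by rewrite integral_indic// setIT.
by rewrite integral_two_point//; first exact/measurable_EFinP.
Qed.

(** Conditioning on the first draw turns the expectation over [n] i.i.d. draws into a finite
    recursion, so that Le Cam's argument becomes an induction on [n] in real arithmetic. *)
Fixpoint two_point_mean (R : realType) (p x : R) (n : nat) :
    (n.-tuple R -> R) -> R :=
  match n with
  | 0 => fun psi => psi [tuple]
  | m.+1 => fun psi =>
      p * two_point_mean p x (fun t => psi [tuple of 0 :: t])
      + (1 - p) * two_point_mean p x (fun t => psi [tuple of x :: t])
  end.

Lemma measurable_tuple_cons1 (R : realType) (n : nat) (a : R) :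
  measurable_fun [set: n.-tuple R] (fun t => tuple_cons (a, t)).
Proof. by apply: measurable_cons => //; exact: measurable_id. Qed.

Lemma integral_iid_two_point (R : realType) (p x : R) (n : nat)
    (psi : n.-tuple R -> R) :
  0 <= p <= 1 -> measurable_fun setT psi -> (forall t, 0 <= psi t) ->
  (\int[iid_law (two_point p x) n]_t (psi t)%:E
   = (two_point_mean p x psi)%:E)%E.
Proof.
move=> p01; elim: n psi => [|n IH] psi mpsi psi0 /=.
  by rewrite integral_dirac ?diracT ?mul1e//; exact/measurable_EFinP.
have mpsi' : measurable_fun setT (EFin \o psi) by exact/measurable_EFinP.
rewrite ge0_integral_distribution//.
have mcons : measurable_fun setT ((EFin \o psi) \o @tuple_cons _ R n).
  exact: measurableT_comp mpsi' (@measurable_tuple_cons _ _ _).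
rewrite fubini_tonelli1; last 2 first.
- exact: mcons.
- by move=> z /=; rewrite lee_fin.
rewrite -/(two_point p x) /fubini_F integral_two_point//.
- have mean1 a : (\int[iid_law (two_point p x) n]_t
      (psi [tuple of a :: t])%:E
      = (two_point_mean p x (fun t => psi [tuple of a :: t]))%:E)%E.
    by apply: IH => //; apply: (measurableT_comp mpsi); exact: measurable_tuple_cons1.
  transitivity (p%:E * (two_point_mean p x (fun t => psi [tuple of 0 :: t]))%:E
    + (1 - p)%:E * (two_point_mean p x (fun t => psi [tuple of x :: t]))%:E)%E.
    by congr (_ * _ + _ * _)%E; exact: mean1.
  by [].
- by apply: (measurable_fun_fubini_tonelli_F _ mcons) => z; rewrite lee_fin.
- by move=> t; apply: integral_ge0 => s _ /=; rewrite lee_fin.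
Qed.

(* Le Cam's two-point bound: min(a, c) >= c - c ^+ 2 / (4 a), and the second
   moment of the likelihood ratio tensorizes over the n draws. *)
Lemma two_point_mean_le_cam (R : realType) (p0 p1 x B : R) (n : nat) (a c : R)
    (psi0 psi1 : n.-tuple R -> R) :
  0 < p0 < 1 -> 0 <= p1 <= 1 -> 0 < a -> 0 <= c -> 0 <= B ->
  (forall t, 0 <= psi0 t) -> (forall t, 0 <= psi1 t) ->
  (forall t, B <= psi0 t + psi1 t) ->
  B * (c - c ^+ 2 / (4 * a) * (p1 ^+ 2 / p0 + (1 - p1) ^+ 2 / (1 - p0)) ^+ n)
  <= a * two_point_mean p0 x psi0 + c * two_point_mean p1 x psi1.
Proof.
move=> /andP[p0_gt0 p0_lt1] /andP[p1_ge0 p1_le1].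
have q0_gt0 : 0 < 1 - p0 by rewrite subr_gt0.
have q1_ge0 : 0 <= 1 - p1 by rewrite subr_ge0.
elim: n a c psi0 psi1 => [|n IH] a c psi0 psi1 a0 c0 B0 psi00 psi10 psiB /=.
  have c4a : 0 <= c ^+ 2 / (4 * a) by rewrite divr_ge0 ?sqr_ge0// mulr_ge0 ?ltW.
  have ca : c - c ^+ 2 / (4 * a) <= a.
    rewrite -subr_ge0 (_ : _ - _ = (2 * a - c) ^+ 2 / (4 * a)).
      by rewrite divr_ge0 ?sqr_ge0// mulr_ge0 ?ltW.
    by field; rewrite gt_eqF.
  rewrite expr0 mulr1; set t := [tuple].
  have := psiB t; have := psi00 t; have := psi10 t.
  move: (psi0 t) (psi1 t) (c ^+ 2 / (4 * a)) c4a ca => u v w w0 ca v0 u0 Buv.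
  have [cw|cw] := ltP (c - w) 0.
    apply: (@le_trans _ _ 0); first by rewrite mulr_ge0_le0// ltW.
    by rewrite addr_ge0// mulr_ge0// ltW.
  apply: (@le_trans _ _ ((u + v) * (c - w))); first exact: ler_wpM2r.
  rewrite mulrDl lerD// mulrC; first exact: ler_wpM2r.
  by rewrite ler_wpM2r//; lra.
set K := _ / p0 + _.
(* A first draw equal to 0 scales the weights [a], [c] by [p0], [p1], hence [c ^+ 2 / (4 * a)] by
   [p1 ^+ 2 / p0]; a draw equal to [x] scales it by [(1 - p1) ^+ 2 / (1 - p0)]. The two factors add
   up to [K], which is why the induction carries arbitrary weights. *)
have := lerD
  (IH (a * p0) (c * p1) (fun t => psi0 [tuple of 0 :: t])
      (fun t => psi1 [tuple of 0 :: t]) (mulr_gt0 a0 p0_gt0) (mulr_ge0 c0 p1_ge0)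
      B0 (fun _ => psi00 _) (fun _ => psi10 _) (fun _ => psiB _))
  (IH (a * (1 - p0)) (c * (1 - p1)) (fun t => psi0 [tuple of x :: t])
      (fun t => psi1 [tuple of x :: t]) (mulr_gt0 a0 q0_gt0)
      (mulr_ge0 c0 q1_ge0)
      B0 (fun _ => psi00 _) (fun _ => psi10 _) (fun _ => psiB _)).
rewrite -/K => H; apply: le_trans (le_trans H _); last first.
  by rewrite le_eqVlt; apply/orP; left; apply/eqP; ring.
rewrite le_eqVlt; apply/orP; left; apply/eqP; rewrite (exprSr K).
move: (K ^+ n) => Kn; rewrite /K; field.
by rewrite !gt_eqF.
Qed.

(** With unit weights the second moment of the likelihood ratio is 1 + chi per draw. The closeness
    hypothesis says n chi <= 1/2, whence (1 + chi)^n <= e^(1/2) <= 2 and the factor 1 - 2/4. *)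
Lemma two_point_mean_sum_ge (R : realType) (p0 p1 x B : R) (n : nat)
    (psi0 psi1 : n.-tuple R -> R) :
  0 < p0 < 1 -> 0 <= p1 <= 1 ->
  n%:R * (p1 - p0) ^+ 2 <= p0 * (1 - p0) / 2 -> 0 <= B ->
  (forall t, 0 <= psi0 t) -> (forall t, 0 <= psi1 t) ->
  (forall t, B <= psi0 t + psi1 t) ->
  B / 2 <= two_point_mean p0 x psi0 + two_point_mean p1 x psi1.
Proof.
move=> p0_01 p1_01 close B0 psi00 psi10 psiB; have /andP[p0_gt0 p0_lt1] := p0_01.
have q0_gt0 : 0 < 1 - p0 by rewrite subr_gt0.
have := two_point_mean_le_cam x p0_01 p1_01 ltr01 ler01 B0 psi00 psi10 psiB.
rewrite !mul1r mulr1 expr1n; apply: le_trans; rewrite ler_wpM2l//.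
set chi := (p1 - p0) ^+ 2 / (p0 * (1 - p0)).
rewrite (_ : _ / p0 + _ = 1 + chi); last by rewrite /chi; field; rewrite !gt_eqF.
have chi0 : 0 <= chi by rewrite divr_ge0 ?sqr_ge0// mulr_ge0// ltW.
have nchi : n%:R * chi <= 1 / 2.
  rewrite /chi mulrA ler_pdivrMr; last exact: mulr_gt0.
  by lra.
have : (1 + chi) ^+ n <= 2; last by lra.
apply: (@le_trans _ _ (expR (n%:R * chi))).
  rewrite expRM_natl lerXn2r ?nnegrE ?expR_ge0 ?expR_ge1Dx//.
  by rewrite addr_ge0.
apply: (@le_trans _ _ (expR (1 / 2))); first by rewrite ler_expR.
(* Inverted, e^(1/2) <= 2 reads e^(-1/2) >= 1/2, which is 1 + t <= e^t at t = -1/2. *)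
rewrite -[leLHS]invrK -[leRHS]invrK lef_pV2 ?posrE ?invr_gt0 ?expR_gt0// -expRN.
by apply: le_trans (expR_ge1Dx _); lra.
Qed.

(** * Newsvendor cost: integrability and one-sided slopes *)

Definition newsvendor_loss (R : realType) (b h q d : R) : R :=
  b * Num.max (d - q) 0 + h * Num.max (q - d) 0.

Lemma newsvendor_loss_ge0 (R : realType) (b h q d : R) :
  0 < b -> 0 < h -> 0 <= newsvendor_loss b h q d.
Proof.
by move=> b0 h0; rewrite /newsvendor_loss /Num.max; do 2 case: ifPn => ?; nra.
Qed.

Lemma newsvendor_loss_ger (R : realType) (b h q d : R) :
  0 < b -> 0 < h -> b * (d - q) <= newsvendor_loss b h q d.
Proof.
by move=> b0 h0; rewrite /newsvendor_loss /Num.max; do 2 case: ifPn => ?; nra.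
Qed.

Lemma newsvendor_loss_gel (R : realType) (b h q d : R) :
  0 < b -> 0 < h -> h * (q - d) <= newsvendor_loss b h q d.
Proof.
by move=> b0 h0; rewrite /newsvendor_loss /Num.max; do 2 case: ifPn => ?; nra.
Qed.

Lemma newsvendor_loss_le_sub (R : realType) (b h q d : R) :
  d <= q -> newsvendor_loss b h q d = h * (q - d).
Proof.
move=> dq; rewrite /newsvendor_loss (max_idPr _) ?subr_le0//.
by rewrite (max_idPl _) ?subr_ge0// mulr0 add0r.
Qed.

Lemma newsvendor_loss_sub_ge (R : realType) (b h q d : R) :
  q <= d -> newsvendor_loss b h q d = b * (d - q).
Proof.
move=> dq; rewrite /newsvendor_loss (max_idPl _) ?subr_ge0//.
by rewrite (max_idPr _) ?subr_le0// mulr0 addr0.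
Qed.

Lemma measurable_newsvendor_loss (R : realType) (b h q : R) :
  measurable_fun setT (newsvendor_loss b h q).
Proof.
apply: measurable_funD; apply: measurable_funM => //.
- by apply: measurable_maxr => //; exact: measurable_funB.
- by apply: measurable_maxr => //; exact: measurable_funB.
Qed.

(** This turns the finite mean required by [demand_class] into integrability of |t|: the two
    integrands differ only on the null set of negative demands. *)
Lemma integral_nonneg_support (R : realType) (F : probability R R) :
  F `]-oo, 0[%classic = 0%E ->
  ('E_F[idfun] = \int[F]_t (`|t|)%:E)%E.
Proof.
move=> F0; rewrite unlock; apply: ae_eq_integral => //.
- by apply/measurable_EFinP; exact: measurable_id.
- by apply/measurable_EFinP; exact: normr_measurable.
exists (`]-oo, 0[%classic); split => // t /= /not_implyP[_ t0].
rewrite in_itv/= ltNge; apply/negP => t_ge0; apply: t0.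
by rewrite ger0_norm.
Qed.

Lemma integrable_newsvendor_loss (R : realType) (b h M q : R)
    (F : probability R R) :
  0 < b -> 0 < h -> demand_class b h M F ->
  F.-integrable setT (EFin \o newsvendor_loss b h q).
Proof.
move=> b0 h0 [F0 EF _].
have intabs : F.-integrable setT (fun t => `|t|%:E).
  apply/integrableP; split.
    by apply/measurable_EFinP; exact: normr_measurable.
  rewrite integral_nonneg_support// in EF.
  by under eq_integral do rewrite abse_EFin normr_id.
have intg : F.-integrable setT
    (fun t => ((b + h) * (`|t| + `|q|))%:E).
  have := integrableD measurableT intabs 
    (finite_measure_integrable_cst F `|q| measurableT).
  by move=> /(integrableZl measurableT (b + h)).
apply: (le_integrable measurableT _ _ intg).
  by apply/measurable_EFinP; exact: measurable_newsvendor_loss.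
move=> t _; rewrite /= lee_fin.
rewrite ger0_norm ?newsvendor_loss_ge0// ger0_norm; last first.
  by rewrite mulr_ge0// ?addr_ge0// ltW.
have [tq|tq] := leP t q.
  rewrite newsvendor_loss_le_sub//.
  have := ler_norm q; have := ler_norm (- t); rewrite normrN.
  by have := normr_ge0 t; have := normr_ge0 q; nra.
rewrite newsvendor_loss_sub_ge; last exact: ltW.
have := ler_norm (- q); have := ler_norm t; rewrite normrN.
by have := normr_ge0 t; have := normr_ge0 q; nra.
Qed.

Lemma newsvendor_cost_fin_num (R : realType) (b h M q : R)
    (F : probability R R) :
  0 < b -> 0 < h -> demand_class b h M F ->
  newsvendor_cost b h F q \is a fin_num.
Proof.
move=> b0 h0 FM; rewrite /newsvendor_cost unlock.
exact: integrable_fin_num (integrable_newsvendor_loss _ b0 h0 FM).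
Qed.

Lemma newsvendor_cost_sub_le (R : realType) (b h M q q' : R)
    (F : probability R R) (A : set R) (u v : R) :
  0 < b -> 0 < h -> demand_class b h M F -> measurable A ->
  (forall d, newsvendor_loss b h q d - newsvendor_loss b h q' d
             <= u + v * \1_A d) ->
  (newsvendor_cost b h F q - newsvendor_cost b h F q'
   <= (u + v * fine (F A))%:E)%E.
Proof.
move=> b0 h0 FM mA lossA; rewrite /newsvendor_cost unlock.
have il r := integrable_newsvendor_loss r b0 h0 FM.
have iA : F.-integrable setT (fun t => (\1_A t)%:E).
  by apply: integrable_indic.
have iu : F.-integrable setT (fun=> u%:E).
  exact: finite_measure_integrable_cst.
have ivA := integrableZl measurableT v iA.
rewrite -integralB_EFin//; [|exact: il|exact: il].
have -> : ((u + v * fine (F A))%:E = \int[F]_t (u%:E + v%:E * (\1_A t)%:E))%E.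
  rewrite integralD// integral_cst//= probability_setT mule1.
  by rewrite integralZl// integral_indic// setIT EFinD EFinM fineK// fin_num_measure.
apply: le_integral => //.
- exact: (integrableB measurableT (il q) (il q')).
- exact: integrableD.
- by move=> t _; rewrite -EFinM -EFinD lee_fin; exact: lossA.
Qed.

(** Convexity of the cost, whose right derivative at [q] is (b + h)(F(q) - rho). The loss difference
    is -h (q' - q) for d <= q and at most b (q' - q) for d > q; these two constants are
    integrated. *)
Lemma newsvendor_cost_sub_right (R : realType) (b h M q q' : R)
    (F : probability R R) :
  0 < b -> 0 < h -> demand_class b h M F -> q <= q' ->
  (newsvendor_cost b h F q - newsvendor_cost b h F q'
   <= ((b + h) * (q' - q) * (critical_ratio b h - law_cdf F q))%:E)%E.
Proof.
move=> b0 h0 FM qq'.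
have -> : (b + h) * (q' - q) * (critical_ratio b h - law_cdf F q)
   = b * (q' - q) + (- (b + h) * (q' - q)) * fine (F `]-oo, q]%classic).
  rewrite /critical_ratio /law_cdf; field.
  by rewrite gt_eqF// addr_gt0.
apply: (newsvendor_cost_sub_le b0 h0 FM) => // d.
rewrite indicE; have [dq|dq] := leP d q.
  rewrite mem_set /= ?in_itv//= !newsvendor_loss_le_sub//; last exact: le_trans qq'.
  by lra.
rewrite memNset; last by rewrite /= in_itv/= leNgt dq.
rewrite mulr0 newsvendor_loss_sub_ge; last exact: ltW.
by have := newsvendor_loss_ger q' d b0 h0; lra.
Qed.

(** The mirror image: the left derivative at [q] involves P(D < q), hence [cdf_left]. *)
Lemma newsvendor_cost_sub_left (R : realType) (b h M q q' : R)
    (F : probability R R) :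
  0 < b -> 0 < h -> demand_class b h M F -> q' <= q ->
  (newsvendor_cost b h F q - newsvendor_cost b h F q'
   <= ((b + h) * (q - q') * (cdf_left F q - critical_ratio b h))%:E)%E.
Proof.
move=> b0 h0 FM qq'.
have -> : (b + h) * (q - q') * (cdf_left F q - critical_ratio b h)
   = - (b * (q - q')) + (b + h) * (q - q') * fine (F `]-oo, q[%classic).
  rewrite /critical_ratio /cdf_left; field.
  by rewrite gt_eqF// addr_gt0.
apply: (newsvendor_cost_sub_le b0 h0 FM) => // d.
rewrite indicE; have [dq|dq] := leP q d.
  rewrite memNset; last by rewrite /= in_itv/= ltNge dq.
  by rewrite mulr0 !newsvendor_loss_sub_ge//; [lra|exact: le_trans dq].
rewrite mem_set /= ?in_itv//= newsvendor_loss_le_sub; last exact: ltW.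
by have := newsvendor_loss_gel q' d b0 h0; lra.
Qed.

(** * Cdfs, optimal orders and costs of two-point laws *)

Lemma cdf_left_le1 (R : realType) (F : probability R R) (x : R) :
  cdf_left F x <= 1.
Proof.
rewrite -lee_fin fineK ?fin_num_measure//.
exact: probability_le1.
Qed.

Lemma law_cdf_le (R : realType) (F : probability R R) (x y : R) :
  x <= y -> law_cdf F x <= law_cdf F y.
Proof.
move=> xy; rewrite fine_le ?fin_num_measure// le_measure ?inE//.
exact: subitvPr.
Qed.

(** Continuity of the measure from below along the intervals ]-oo, x - 1/(n+1)]. *)
Lemma cdf_left_le (R : realType) (F : probability R R) (x r : R) :
  (forall y, y < x -> law_cdf F y <= r) -> cdf_left F x <= r.
Proof.
move=> Fr; rewrite -lee_fin fineK ?fin_num_measure//.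
pose E n := `]-oo, x - n.+1%:R^-1]%classic.
have EU : `]-oo, x[%classic = \bigcup_n E n.
  apply/seteqP; split => [y /=|y [n _]]; rewrite /E /= !in_itv/=.
    by move=> /ltr_add_invr[n yn]; exists n => //=; rewrite in_itv/= lerBrDr ltW.
  by move=> /le_lt_trans; apply; rewrite gtrBl invr_gt0.
have ndE : nondecreasing_seq E.
  move=> m n mn; apply/subsetPset; apply: subitvPr.
  by rewrite bnd_simp lerB// lef_pV2 ?posrE// ler_nat.
have mE n : measurable (E n) by exact: measurable_itv.
have cvgE := nondecreasing_cvg_mu (mu := F) mE (bigcup_measurable (fun n _ => mE n)) ndE.
rewrite EU -(cvg_lim _ cvgE)//; apply: lime_le.
  by apply/cvg_ex; eexists; exact: cvgE.
apply: nearW => n /=; rewrite -[F _]fineK ?fin_num_measure// lee_fin.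
by apply: Fr; rewrite gtrBl invr_gt0.
Qed.

Lemma law_cdf_two_point (R : realType) (p x t : R) :
  0 <= p <= 1 ->
  law_cdf (two_point p x) t = p * (0 <= t)%R%:R + (1 - p) * (x <= t)%R%:R.
Proof.
move=> p01; rewrite /law_cdf two_pointE// !indicE /=.
by rewrite !mem_setE !in_itv.
Qed.

Lemma cdf_left_two_point (R : realType) (p x t : R) :
  0 <= p <= 1 ->
  cdf_left (two_point p x) t = p * (0 < t)%R%:R + (1 - p) * (x < t)%R%:R.
Proof.
move=> p01; rewrite /cdf_left two_pointE// !indicE /=.
by rewrite !mem_setE !in_itv.
Qed.

Lemma newsvendor_cost_two_point (R : realType) (b h p x q : R) :
  0 < b -> 0 < h -> 0 <= p <= 1 ->
  newsvendor_cost b h (two_point p x) q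
  = (p * newsvendor_loss b h q 0 + (1 - p) * newsvendor_loss b h q x)%:E.
Proof.
move=> b0 h0 p01; rewrite /newsvendor_cost unlock integral_two_point//.
  by apply/measurable_EFinP; exact: measurable_newsvendor_loss.
by move=> t; rewrite lee_fin; exact: newsvendor_loss_ge0.
Qed.

(** The set of q with F(q) >= rho is exactly [0, +oo[; positivity of rho excludes negative q, where
    the cdf vanishes. *)
Lemma qstar_two_point_high (R : realType) (b h p x : R) :
  0 < x -> 0 <= p <= 1 -> 0 < critical_ratio b h <= p ->
  qstar b h (two_point p x) = 0.
Proof.
move=> x0 p01 /andP[rho0 rhop]; have /andP[p0 p1] := p01.
rewrite /qstar -[RHS](@inf_itv R +oo%O true 0)//; congr inf.
apply/seteqP; split => q; rewrite /= law_cdf_two_point// in_itv/= andbT.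
  apply: contra_leT; rewrite -ltNge => q0.
  by rewrite [0 <= q]leNgt [x <= q]leNgt q0 (lt_trans q0 x0) !mulr0 addr0.
by move=> -> ; rewrite mulr1 (le_trans rhop)// lerDl mulr_ge0// subr_ge0.
Qed.

Lemma qstar_two_point_low (R : realType) (b h p x : R) :
  0 < x -> 0 <= p <= 1 -> p < critical_ratio b h <= 1 ->
  qstar b h (two_point p x) = x.
Proof.
move=> x0 p01 /andP[rhop rho1]; have /andP[p0 p1] := p01.
rewrite /qstar -[RHS](@inf_itv R +oo%O true x)//; congr inf.
apply/seteqP; split => q; rewrite /= law_cdf_two_point// in_itv/= andbT.
  apply: contra_leT; rewrite -ltNge => qx; rewrite [x <= q]leNgt qx mulr0 addr0.
  by apply: le_lt_trans rhop; case: (0 <= q); rewrite ?mulr1// mulr0.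
by move=> xq; rewrite xq (le_trans (ltW x0))// !mulr1 addrC subrK.
Qed.

Lemma critical_ratio_itv (R : realType) (b h : R) :
  0 < b -> 0 < h -> 0 < critical_ratio b h < 1.
Proof.
move=> b0 h0; have bh : 0 < b + h by exact: addr_gt0.
by rewrite divr_gt0//= ltr_pdivrMr// mul1r ltrDl.
Qed.

Lemma two_point_demand_class (R : realType) (b h M p x : R) :
  0 < b -> 0 < h -> 0 < x <= M -> 0 <= p <= 1 ->
  demand_class b h M (two_point p x).
Proof.
move=> b0 h0 /andP[x0 xM] p01.
have /andP[rho0 rho1] := critical_ratio_itv b0 h0.
have F0 : two_point p x `]-oo, 0[%classic = 0%E.
  rewrite two_pointE// !indicE !mem_setE !in_itv/= ltxx ltNge (ltW x0).
  by rewrite !mulr0 addr0.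
split => //.
  rewrite integral_nonneg_support// integral_two_point//.
    by rewrite -!EFinM -EFinD ltry.
  by apply/measurable_EFinP; exact: normr_measurable.
have [pr|rp] := ltP p (critical_ratio b h).
  by rewrite qstar_two_point_low// pr ltW.
by rewrite qstar_two_point_high ?rho0// (le_trans (ltW x0)).
Qed.

(** * Lower bounds on the excess regret *)

Lemma regret_ge (R : realType) (b h M lambda q r : R) (F G : probability R R) :
  ambiguity_set b h M lambda G F ->
  (r%:E <= newsvendor_cost b h F q - newsvendor_cost b h F (qstar b h F))%E ->
  (r%:E <= regret b h M lambda G q)%E.
Proof. by move=> GF /le_trans; apply; apply: ereal_sup_ubound; exists F. Qed.

(** The minimax regret is at most the regret at the reference order [q'], which gives r - r', and at
    most the regret at [q], which gives the 0 in the maximum. *)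
Lemma excess_regret_ge (R : realType) (b h M lambda q q' r r' : R)
    (G : probability R R) :
  0 <= q <= M -> 0 <= q' <= M ->
  (r%:E <= regret b h M lambda G q)%E ->
  (regret b h M lambda G q' <= r'%:E)%E ->
  ((Num.max 0 (r - r'))%:E
   <= regret b h M lambda G q - minimax_regret b h M lambda G)%E.
Proof.
move=> qM q'M rq rq'.
have mq : (minimax_regret b h M lambda G <= regret b h M lambda G q)%E.
  by apply: ereal_inf_lbound; exists q.
have mq' : (minimax_regret b h M lambda G <= r'%:E)%E.
  by apply: le_trans rq'; apply: ereal_inf_lbound; exists q'.
rewrite EFin_max ge_max; apply/andP; split; last by rewrite EFinB leeB.
(* The finite bounds exclude a regret -oo and a minimax value +oo; in the other infinite cases the
   difference is +oo. *)
move: mq rq mq'; move: (regret _ _ _ _ _ _) (minimax_regret _ _ _ _ _).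
move=> [s| |] [m| |] // ms rs mr; try exact: leey.
by rewrite -EFinB lee_fin subr_ge0 -lee_fin.
Qed.

(* The ratio is reached at 0, which is optimal for the whole ambiguity set. *)
Lemma excess_regret_high (R : realType) (b h M lambda p x q : R) :
  0 < b -> 0 < h -> 0 < lambda -> lambda <= M -> 0 < x <= lambda ->
  critical_ratio b h <= p <= 1 -> 0 <= q <= M ->
  ((Num.max 0 ((b + h) * (p - critical_ratio b h) * q))%:E
   <= regret b h M lambda (two_point p x) q
      - minimax_regret b h M lambda (two_point p x))%E.
Proof.
move=> b0 h0 l0 lM /andP[x0 xl] /andP[rhop p1] /andP[q0 qM].
have /andP[rho0 rho1] := critical_ratio_itv b0 h0.
have p01 : 0 <= p <= 1 by rewrite p1 (le_trans (ltW rho0)).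
have GM : demand_class b h M (two_point p x).
  by apply: two_point_demand_class; rewrite ?x0 ?(le_trans xl).
rewrite -[X in Num.max 0 X]subr0; apply: (@excess_regret_ge _ _ _ _ _ _ 0).
- by rewrite q0.
- by rewrite lexx (le_trans _ lM)// ltW.
- apply: (@regret_ge _ _ _ _ _ _ _ (two_point p x)); first by split.
  rewrite qstar_two_point_high ?rho0// !newsvendor_cost_two_point// -EFinB.
  rewrite lee_fin (newsvendor_loss_le_sub _ _ q0) (newsvendor_loss_le_sub _ _ (lexx 0)).
  rewrite (newsvendor_loss_sub_ge _ _ (ltW x0)).
  have := newsvendor_loss_ger q x b0 h0.
  have -> : (b + h) * (p - critical_ratio b h) * q = ((b + h) * p - b) * q.
    by rewrite /critical_ratio; field; rewrite gt_eqF// addr_gt0.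
  have /andP[_] := p01; rewrite -subr_ge0 => p1'; nra.
(* The order 0 has regret at most 0: every F in the ambiguity set has F(0-) = 0 and F(0) >= rho, so
   0 costs no more than any order on either side. *)
- apply: ge_ereal_sup => _ [F [FM FG] <-].
  have F0 : critical_ratio b h <= law_cdf F 0.
    rewrite FG// law_cdf_two_point// lexx mulr1 (le_trans rhop)// lerDl.
    by rewrite mulr_ge0// subr_ge0.
  have [q'0|q'0] := leP 0 (qstar b h F).
    apply: le_trans (newsvendor_cost_sub_right b0 h0 FM q'0) _.
    by rewrite lee_fin mulr_ge0_le0 ?mulr_ge0 ?subr_ge0 ?subr_le0// ltW// addr_gt0.
  apply: le_trans (newsvendor_cost_sub_left b0 h0 FM (ltW q'0)) _.
  rewrite lee_fin mulr_ge0_le0 ?mulr_ge0 ?subr_ge0 ?subr_le0//;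
    try by rewrite ltW// addr_gt0.
  by have [F00 _ _] := FM; rewrite /cdf_left F00 ltW.
Qed.

(* The ratio is reached at x, which is optimal for the whole ambiguity set. *)
Lemma excess_regret_low (R : realType) (b h M lambda p x q : R) :
  0 < b -> 0 < h -> 0 < x < lambda -> lambda <= M ->
  0 <= p < critical_ratio b h -> 0 <= q <= M ->
  ((Num.max 0 ((b + h) * (critical_ratio b h - p) * (x - q)))%:E
   <= regret b h M lambda (two_point p x) q
      - minimax_regret b h M lambda (two_point p x))%E.
Proof.
move=> b0 h0 /andP[x0 xl] lM /andP[p0 prho] /andP[q0 qM].
have /andP[rho0 rho1] := critical_ratio_itv b0 h0.
have p01 : 0 <= p <= 1 by rewrite p0 (le_trans (ltW prho))// ltW.
have xM : x <= M by rewrite (le_trans (ltW xl)).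
have GM : demand_class b h M (two_point p x).
  by apply: two_point_demand_class; rewrite ?x0 ?(le_trans xl).
rewrite -[X in Num.max 0 X]subr0; apply: (@excess_regret_ge _ _ _ _ _ _ x).
- by rewrite q0.
- by rewrite xM ltW.
- apply: (@regret_ge _ _ _ _ _ _ _ (two_point p x)); first by split.
  rewrite qstar_two_point_low//; last by rewrite prho ltW.
  rewrite !newsvendor_cost_two_point// -EFinB.
  rewrite lee_fin (newsvendor_loss_le_sub _ _ q0) (newsvendor_loss_le_sub _ _ (lexx x)).
  rewrite (newsvendor_loss_le_sub _ _ (ltW x0)).
  have := newsvendor_loss_ger q x b0 h0.
  have -> : (b + h) * (critical_ratio b h - p) * (x - q) = (b - (b + h) * p) * (x - q).
    by rewrite /critical_ratio; field; rewrite gt_eqF// addr_gt0.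
  have /andP[_] := p01; rewrite -subr_ge0 => p1'; nra.
(* As x < lambda, every F in the ambiguity set satisfies F(x-) <= rho <= F(x), so x is a common
   rho-quantile and has regret at most 0. *)
- apply: ge_ereal_sup => _ [F [FM FG] <-].
  have Fx : critical_ratio b h <= law_cdf F x.
    by rewrite FG// law_cdf_two_point// lexx (ltW x0) !mulr1 addrC subrK ltW.
  have Fx' : cdf_left F x <= critical_ratio b h.
    apply: cdf_left_le => y yx; rewrite FG ?(lt_trans yx)// law_cdf_two_point//.
    rewrite leNgt [_ <= y]leNgt yx mulr0 addr0 -leNgt (le_trans _ (ltW prho))//.
    by rewrite ler_piMr// lern1 leq_b1.
  have [q'x|q'x] := leP x (qstar b h F).
    apply: le_trans (newsvendor_cost_sub_right b0 h0 FM q'x) _.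
    by rewrite lee_fin mulr_ge0_le0 ?mulr_ge0 ?subr_ge0 ?subr_le0// ltW// addr_gt0.
  apply: le_trans (newsvendor_cost_sub_left b0 h0 FM (ltW q'x)) _.
  rewrite lee_fin mulr_ge0_le0 ?mulr_ge0 ?subr_ge0 ?subr_le0//;
    try by rewrite ltW// addr_gt0.
Qed.

(** * Regret when the second atom sits at the observable boundary *)

Section ambiguous_ratio.
Context (R : realType) (b h M lambda p : R).
Context (b0 : 0 < b) (h0 : 0 < h) (l0 : 0 < lambda) (lM : lambda <= M).
Context (prho : 0 <= p < critical_ratio b h).
Local Notation rho := (critical_ratio b h).
Local Notation G := (two_point p lambda).

(** Three positions of the optimum s of F: if s >= q', then F(q') >= p and s <= M give the underage
    term; if lambda <= s < q', then F(q'-) <= 1 gives (b + h)(1 - rho)(q' - lambda) = h (q' -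
    lambda); if s < lambda, then F(lambda-) <= rho shows that lambda costs no more than s, and
    lambda replaces s. *)
Lemma regret_ambiguous_le (q' r' : R) :
  lambda <= q' <= M ->
  (b + h) * (rho - p) * (M - q') <= r' -> h * (q' - lambda) <= r' ->
  (regret b h M lambda G q' <= r'%:E)%E.
Proof.
move=> /andP[lq' q'M] rM rl; have /andP[p0 pr] := prho.
have /andP[rho0 rho1] := critical_ratio_itv b0 h0.
have p01 : 0 <= p <= 1 by rewrite p0 ltW// (lt_trans pr).
have bh0 : 0 < b + h by exact: addr_gt0.
have hE : h = (b + h) * (1 - rho).
  by rewrite /critical_ratio; field; rewrite gt_eqF.
apply: ge_ereal_sup => _ [F [FM FG] <-].
have [_ _ sM] := FM; set s := qstar b h F in sM *.
have Fq' : p <= law_cdf F q'.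
  apply: le_trans (law_cdf_le F (le_trans (ltW l0) lq')).
  by rewrite FG// law_cdf_two_point// lexx mulr1 [_ <= 0]leNgt l0 mulr0 addr0.
have Fl : cdf_left F lambda <= rho.
  apply: cdf_left_le => y yl; rewrite FG// law_cdf_two_point//.
  rewrite [lambda <= y]leNgt yl mulr0 addr0 (le_trans _ (ltW pr))//.
  by rewrite ler_piMr// lern1 leq_b1.
have [q's|sq'] := leP q' s.
  apply: le_trans (newsvendor_cost_sub_right b0 h0 FM q's) _.
  rewrite lee_fin (le_trans _ rM)// -!mulrA ler_pM2l// mulrC.
  apply: (@le_trans _ _ ((rho - p) * (s - q'))).
    by rewrite ler_wpM2r ?subr_ge0// lerB.
  by rewrite ler_wpM2l ?subr_ge0 ?lerB// ltW.
have left_le t : t <= q' -> lambda <= t ->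
    (newsvendor_cost b h F q' - newsvendor_cost b h F t
     <= (h * (q' - lambda))%:E)%E.
  move=> tq' lt; apply: le_trans (newsvendor_cost_sub_left b0 h0 FM tq') _.
  rewrite lee_fin [X in _ <= X * _]hE -!mulrA ler_pM2l// [leRHS]mulrC.
  apply: (@le_trans _ _ ((q' - t) * (1 - rho))).
    by rewrite ler_wpM2l ?subr_ge0// lerB// cdf_left_le1.
  by rewrite ler_wpM2r ?subr_ge0 ?lerB// ltW.
have [ls|sl] := leP lambda s.
  by apply: le_trans (left_le _ (ltW sq') ls) _; rewrite lee_fin.
have := newsvendor_cost_sub_left b0 h0 FM (ltW sl).
have := left_le _ lq' (lexx _).
have fin t := newsvendor_cost_fin_num t b0 h0 FM.
rewrite -(fineK (fin q')) -(fineK (fin s)) -(fineK (fin lambda)).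
rewrite -!EFinB !lee_fin.
have : (b + h) * (lambda - s) * (cdf_left F lambda - rho) <= 0.
  by rewrite mulr_ge0_le0 ?mulr_ge0 ?subr_ge0 ?subr_le0// ltW.
by lra.
Qed.

Lemma regret_ambiguous_ge_above (q : R) :
  0 <= q <= M ->
  (((b + h) * (rho - p) * (M - q))%:E <= regret b h M lambda G q)%E.
Proof.
move=> /andP[q0 qM]; have /andP[p0 pr] := prho.
have /andP[rho0 rho1] := critical_ratio_itv b0 h0.
have p01 : 0 <= p <= 1 by rewrite p0 ltW// (lt_trans pr).
have M0 : 0 < M by exact: lt_le_trans lM.
have FM : demand_class b h M (two_point p M).
  by apply: two_point_demand_class; rewrite ?M0 ?lexx.
(* Moving the mass 1 - p from lambda to M keeps the cdf below lambda and makes M optimal. *)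
apply: (@regret_ge _ _ _ _ _ _ _ (two_point p M)).
  split=> // y yl; rewrite !law_cdf_two_point//.
  by rewrite [M <= y]leNgt [lambda <= y]leNgt yl (lt_le_trans yl).
rewrite qstar_two_point_low//; last by rewrite pr ltW.
rewrite !newsvendor_cost_two_point// -EFinB lee_fin.
rewrite (newsvendor_loss_le_sub _ _ q0) (newsvendor_loss_le_sub _ _ (lexx M)).
rewrite (newsvendor_loss_le_sub _ _ (ltW M0)) (newsvendor_loss_sub_ge _ _ qM).
rewrite le_eqVlt; apply/orP; left; apply/eqP; rewrite /critical_ratio; field.
by rewrite gt_eqF// addr_gt0.
Qed.

Lemma regret_ambiguous_ge_below (q : R) :
  0 <= q <= M -> ((h * (q - lambda))%:E <= regret b h M lambda G q)%E.
Proof.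
move=> /andP[q0 qM]; have /andP[p0 pr] := prho.
have /andP[rho0 rho1] := critical_ratio_itv b0 h0.
have p01 : 0 <= p <= 1 by rewrite p0 ltW// (lt_trans pr).
have GM : demand_class b h M G.
  by apply: two_point_demand_class; rewrite ?l0.
apply: (@regret_ge _ _ _ _ _ _ _ G); first by split.
rewrite qstar_two_point_low//; last by rewrite pr ltW.
rewrite !newsvendor_cost_two_point// -EFinB lee_fin.
rewrite (newsvendor_loss_le_sub _ _ q0) (newsvendor_loss_le_sub _ _ (lexx lambda)).
rewrite (newsvendor_loss_le_sub _ _ (ltW l0)).
have := newsvendor_loss_gel q lambda b0 h0.
have /andP[_] := p01; rewrite -subr_ge0 => p1'; nra.
Qed.

(** By the balance condition the underage term bounds the whole regret at [q'], so the excess is at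
    least the change of this affine term between [q'] and [q]. *)
Lemma excess_regret_ambiguous_below (q q' : R) :
  0 <= q <= M -> lambda <= q' <= M ->
  h * (q' - lambda) <= (b + h) * (rho - p) * (M - q') ->
  ((Num.max 0 ((b + h) * (rho - p) * (q' - q)))%:E
   <= regret b h M lambda G q - minimax_regret b h M lambda G)%E.
Proof.
move=> qM q'M balance.
have -> : (b + h) * (rho - p) * (q' - q)
   = (b + h) * (rho - p) * (M - q) - (b + h) * (rho - p) * (M - q') by ring.
apply: excess_regret_ge (regret_ambiguous_ge_above qM) _ => //; last first.
  exact: regret_ambiguous_le q'M (lexx _) balance.
by have /andP[lq' ->] := q'M; rewrite (le_trans (ltW l0) lq').
Qed.

Lemma excess_regret_ambiguous_above (q q' : R) :
  0 <= q <= M -> lambda <= q' <= M ->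
  (b + h) * (rho - p) * (M - q') <= h * (q' - lambda) ->
  ((Num.max 0 (h * (q - q')))%:E
   <= regret b h M lambda G q - minimax_regret b h M lambda G)%E.
Proof.
move=> qM q'M balance.
have -> : h * (q - q') = h * (q - lambda) - h * (q' - lambda) by ring.
apply: excess_regret_ge (regret_ambiguous_ge_below qM) _ => //; last first.
  exact: regret_ambiguous_le q'M balance (lexx _).
by have /andP[lq' ->] := q'M; rewrite (le_trans (ltW l0) lq').
Qed.

End ambiguous_ratio.

(** * From pointwise excess regret to the worst-case law *)

(** No measurability is assumed, because [g] will be the excess regret, which involves a supremum
    over a family of laws. The integral of a nonnegative function is a supremum over simple
    functions below it, so it grows with the function. *)
Lemma ge0_le_integralT d (T : measurableType d) (R : realType)
    (mu : {measure set T -> \bar R}) (f g : T -> \bar R) :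
  (forall t, 0 <= f t)%E -> (forall t, f t <= g t)%E ->
  (\int[mu]_t f t <= \int[mu]_t g t)%E.
Proof.
move=> f0 fg; rewrite !ge0_integralTE//; last first.
  by move=> t; exact: le_trans (fg t).
apply: ereal_sup_le => _ [k kf <-].
by exists k => // t; exact: le_trans (kf t) (fg t).
Qed.

Lemma measurable_censor (R : realType) (lambda : R) (N : nat) :
  measurable_fun [set: N.-tuple R] (@censor R lambda N).
Proof.
apply/measurable_fun_tnthP => i.
rewrite (_ : _ \o _ = (fun t : N.-tuple R => Num.min (tnth t i) lambda)).
  by apply: measurable_minr => //; exact: measurable_tnth.
by apply/funext => t /=; rewrite tnth_map.
Qed.

Lemma worst_case_excess_ge (R : realType) (b h M lambda p0 p1 x mu u0 u1 : R)
    (N : nat) (qpi : N.-tuple R -> R) (S : set (probability R R)) :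
  0 < p0 < 1 -> 0 <= p1 <= 1 ->
  N%:R * (p1 - p0) ^+ 2 <= p0 * (1 - p0) / 2 -> 0 <= mu -> u1 <= u0 ->
  policy M qpi -> S (two_point p0 x) -> S (two_point p1 x) ->
  (forall q : R, 0 <= q <= M -> ((Num.max 0 (mu * (u0 - q)))%:E
    <= regret b h M lambda (two_point p0 x) q
       - minimax_regret b h M lambda (two_point p0 x))%E) ->
  (forall q : R, 0 <= q <= M -> ((Num.max 0 (mu * (q - u1)))%:E
    <= regret b h M lambda (two_point p1 x) q
       - minimax_regret b h M lambda (two_point p1 x))%E) ->
  ((mu * (u0 - u1) / 4)%:E <= worst_case_excess b h M lambda qpi S)%E.
Proof.
move=> p0_01 p1_01 close mu0 u10 [mqpi qpiM] S0 S1 ex0 ex1.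
have /andP[p0_gt0 p0_lt1] := p0_01.
have mq : measurable_fun setT (fun t => qpi (censor lambda t)).
  exact: measurableT_comp mqpi (@measurable_censor _ _ _).
pose psi0 t : R := Num.max 0 (mu * (u0 - qpi (censor lambda t))).
pose psi1 t : R := Num.max 0 (mu * (qpi (censor lambda t) - u1)).
have psi00 t : 0 <= psi0 t by rewrite le_max lexx.
have psi10 t : 0 <= psi1 t by rewrite le_max lexx.
have mpsi0 : measurable_fun setT psi0.
  by apply: measurable_maxr => //; apply: measurable_funM => //; exact: measurable_funB.
have mpsi1 : measurable_fun setT psi1.
  by apply: measurable_maxr => //; apply: measurable_funM => //; exact: measurable_funB.
have mean_le (p : R) (psi : N.-tuple R -> R) : 0 <= p <= 1 -> measurable_fun setT psi ->
    (forall t, 0 <= psi t) -> S (two_point p x) ->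
    (forall t, ((psi t)%:E <= regret b h M lambda (two_point p x)
       (qpi (censor lambda t)) - minimax_regret b h M lambda (two_point p x))%E) ->
    ((two_point_mean p x psi)%:E <= worst_case_excess b h M lambda qpi S)%E.
  move=> p01 mpsi psi_ge0 Sp le_ex; rewrite -integral_iid_two_point//.
  apply: (@le_trans _ _ (expected_excess_regret b h M lambda qpi (two_point p x))).
    by apply: ge0_le_integralT => // t; rewrite lee_fin.
  by apply: ereal_sup_ubound; exists (two_point p x).
have p0_01' : 0 <= p0 <= 1 by rewrite !ltW.
have le0 := mean_le _ _ p0_01' mpsi0 psi00 S0 (fun t => ex0 _ (qpiM _)).
have le1 := mean_le _ _ p1_01 mpsi1 psi10 S1 (fun t => ex1 _ (qpiM _)).
have := two_point_mean_sum_ge x p0_01 p1_01 close _ psi00 psi10 _.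
move=> /(_ (mu * (u0 - u1))) test.
have {}test : mu * (u0 - u1) / 2
    <= two_point_mean p0 x psi0 + two_point_mean p1 x psi1.
  apply: test; first by rewrite mulr_ge0// subr_ge0.
  move=> t; rewrite (_ : mu * _ = mu * (u0 - qpi (censor lambda t))
    + mu * (qpi (censor lambda t) - u1)); last by ring.
  by rewrite lerD// le_max lexx orbT.
have [c0|c0] := leP (mu * (u0 - u1) / 4) (two_point_mean p0 x psi0).
  by apply: le_trans le0; rewrite lee_fin.
apply: le_trans le1; rewrite lee_fin.
by lra.
Qed.

(** * The three regimes, with m = min(rho, 1 - rho) and w = 1 / sqrt N *)

Section regimes.
Context (R : realType) (b h lambda M : R).
Context (b0 : 0 < b) (h0 : 0 < h) (l0 : 0 < lambda) (lM : lambda < M).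
Context (N : nat) (qpi : N.-tuple R -> R) (N0 : (0 < N)%N).
Context (qpiM : policy M qpi).
Local Notation rho := (critical_ratio b h).
Local Notation m := (Num.min rho (1 - rho)).
Local Notation w := ((Num.sqrt N%:R)^-1 : R).

Lemma min_ratio_itv : [/\ 0 < m, m <= rho & m <= 1 - rho].
Proof.
have /andP[rho0 rho1] := critical_ratio_itv b0 h0.
split.
- by rewrite lt_min rho0 subr_gt0.
- by rewrite ge_min lexx.
- by rewrite ge_min lexx orbT.
Qed.

Lemma inv_sqrt_itv : [/\ 0 < w, w <= 1 & N%:R * w ^+ 2 = 1].
Proof.
have N1 : 1 <= N%:R :> R by rewrite ler1n.
have sN1 : 1 <= Num.sqrt N%:R :> R by rewrite -[leLHS]sqrtr1 ler_wsqrtr.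
have sN0 : 0 < Num.sqrt N%:R :> R by exact: lt_le_trans sN1.
split; first by rewrite invr_gt0.
  by rewrite invf_le1.
by rewrite exprVn sqr_sqrtr ?ler0n// mulfV// gt_eqF// (lt_le_trans _ N1).
Qed.

(** The construction yields bounds without the factors sqrt(1 - rho) and e^(-1/2); these are
    inserted at the end as numbers in [0, 1]. *)
Lemma shrink_factors :
  [/\ 0 <= Num.sqrt (1 - rho) <= 1 & 0 <= expR (- 2^-1 : R) <= 1].
Proof.
have /andP[rho0 rho1] := critical_ratio_itv b0 h0.
split; rewrite ?sqrtr_ge0 ?expR_ge0/=.
  by rewrite -[leRHS]sqrtr1 ler_wsqrtr// gerBl ltW.
by rewrite -[leRHS]expR0 ler_expR oppr_le0 invr_ge0.
Qed.

(** Shared by the first two regimes: targets x and 0 with slope (b + h) d give (b + h) d x / 4,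
    whence the 32. The excess bound at rho - d is a hypothesis because its proof differs between x <
    lambda and x = lambda. *)
Lemma worst_case_straddling (S : set (probability R R)) (x : R) :
  let d := m / 8 * w in
  0 < x <= lambda ->
  S (two_point (rho - d) x) -> S (two_point (rho + d) x) ->
  (forall q : R, 0 <= q <= M -> ((Num.max 0 ((b + h) * d * (x - q)))%:E
    <= regret b h M lambda (two_point (rho - d) x) q
       - minimax_regret b h M lambda (two_point (rho - d) x))%E) ->
  (((x * (b + h) * Num.sqrt (1 - rho) * m * expR (- 2^-1) / (32 * Num.sqrt N%:R)))%:E
   <= worst_case_excess b h M lambda qpi S)%E.
Proof.
move=> d /andP[x0 xl] S0 S1 ex0.
have /andP[rho0 rho1] := critical_ratio_itv b0 h0.
have [m0 mr mr'] := min_ratio_itv; have [w0 w1 Nw] := inv_sqrt_itv.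
have [/andP[s0 s1] /andP[e0 e1]] := shrink_factors.
have bh0 : 0 < b + h by exact: addr_gt0.
have dm : 0 < d <= m / 8.
  by rewrite /d mulr_gt0 ?divr_gt0//= ler_piMr// divr_ge0// ltW.
have /andP[d0 d1] := dm.
have Nd : N%:R * d ^+ 2 = m ^+ 2 / 64.
  transitivity (N%:R * w ^+ 2 * (m ^+ 2 / 64)); last by rewrite Nw mul1r.
  by rewrite /d; move: w => v; field.
have H : (((b + h) * d * (x - 0) / 4)%:E
    <= worst_case_excess b h M lambda qpi S)%E.
  apply: (@worst_case_excess_ge _ b h M lambda (rho - d) (rho + d) x) => //.
  - by apply/andP; split; lra.
  - by apply/andP; split; lra.
  (* Here N (2 d)^2 = m^2 / 16, while p0 >= 7 m / 8 and 1 - p0 >= m. *)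
  - rewrite (_ : N%:R * _ = 4 * (N%:R * d ^+ 2)); last by ring.
    rewrite Nd; nra.
  - by rewrite mulr_ge0// ltW.
  - exact: ltW.
  - move=> q qM; rewrite subr0 (_ : (b + h) * d = (b + h) * (rho + d - rho)).
      apply: excess_regret_high => //; first exact: ltW.
        by rewrite x0.
      by apply/andP; split; lra.
    by ring.
apply: le_trans H; rewrite lee_fin subr0 invfM.
rewrite (_ : _ * d * x / 4 = x * (b + h) * (m * w) / 32); last first.
  by rewrite /d; move: w => v; field.
rewrite (_ : _ * (_ * w) = x * (b + h) * (m * w) / 32
  * (Num.sqrt (1 - rho) * expR (- 2^-1))); last by ring.
apply: ler_piMr; last by rewrite mulr_ile1.
by rewrite divr_ge0// !mulr_ge0// ltW.
Qed.

Lemma worst_case_identifiable :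
  ((lambda * (b + h) * Num.sqrt (1 - rho) * m * expR (- 2^-1)
    / (64 * Num.sqrt N%:R))%:E
   <= worst_case_excess b h M lambda qpi
        (identifiable b h M lambda (m / 8) N))%E.
Proof.
have /andP[rho0 rho1] := critical_ratio_itv b0 h0.
have [m0 mr mr'] := min_ratio_itv; have [w0 w1 Nw] := inv_sqrt_itv.
have d0 : 0 < m / 8 * w by rewrite mulr_gt0// divr_gt0.
have d1 : m / 8 * w <= m / 8 by rewrite ler_piMr// divr_ge0// ltW.
(* With x = lambda / 2 all the mass lies below lambda, so P(D < lambda) = 1 > rho + (m / 8) w for
   any p; halving x turns 32 into 64. *)
have x0 : 0 < lambda / 2 by rewrite divr_gt0.
have xl : lambda / 2 < lambda by lra.
have memS p : 0 <= p <= 1 ->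
    identifiable b h M lambda (m / 8) N (two_point p (lambda / 2)).
  move=> p01; split.
    by apply: two_point_demand_class; rewrite ?x0//= ltW// (lt_trans xl).
  by rewrite cdf_left_two_point// l0 xl !mulr1 [ltRHS]addrC subrK; lra.
apply: le_trans (@worst_case_straddling _ (lambda / 2) _ _ _ _).
- rewrite lee_fin le_eqVlt; apply/orP; left; apply/eqP; field.
  by rewrite -invr_eq0 gt_eqF.
- by rewrite x0 ltW.
- by apply: memS; apply/andP; split; lra.
- by apply: memS; apply/andP; split; lra.
- move=> q qM; rewrite [X in (b + h) * X](_ : _ = rho - (rho - m / 8 * w)).
    apply: excess_regret_low => //; rewrite ?x0//; first exact: ltW.
    by apply/andP; split; lra.
  by ring.
Qed.

Lemma worst_case_knife_edge :
  ((lambda * (b + h) * Num.sqrt (1 - rho) * m * expR (- 2^-1)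
    / (32 * Num.sqrt N%:R))%:E
   <= worst_case_excess b h M lambda qpi
        (knife_edge b h M lambda (m / 8) N))%E.
Proof.
have /andP[rho0 rho1] := critical_ratio_itv b0 h0.
have [m0 mr mr'] := min_ratio_itv; have [w0 w1 Nw] := inv_sqrt_itv.
have d0 : 0 < m / 8 * w by rewrite mulr_gt0// divr_gt0.
have d1 : m / 8 * w <= m / 8 by rewrite ler_piMr// divr_ge0// ltW.
(* With x = lambda, P(D < lambda) is p itself, and rho - d, rho + d are the endpoints of the closed
   window. *)
have memS p : 0 <= p <= 1 -> `|p - rho| <= m / 8 * w ->
    knife_edge b h M lambda (m / 8) N (two_point p lambda).
  move=> p01 pr; split.
    by apply: two_point_demand_class; rewrite ?l0//= ltW.
  by rewrite cdf_left_two_point// l0 ltxx mulr1 mulr0 addr0.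
apply: (@worst_case_straddling _ lambda).
- by rewrite l0 lexx.
- apply: memS; first by apply/andP; split; lra.
  by rewrite addrAC subrr add0r normrN gtr0_norm.
- apply: memS; first by apply/andP; split; lra.
  by rewrite addrAC subrr add0r gtr0_norm.
- move=> q qM; rewrite [X in (b + h) * X](_ : _ = rho - (rho - m / 8 * w)).
    apply: excess_regret_ambiguous_below => //; first exact: ltW.
    + by apply/andP; split; lra.
    + by rewrite lexx ltW.
    + by rewrite subrr mulr0 !mulr_ge0 ?subr_ge0 ?addr_ge0 ?ltW//; lra.
  by ring.
Qed.

(* the minimizer of max((b+h)(rho-p)(M-q), h(q-lambda)) *)
Definition balance_point (p : R) : R :=
  lambda + (M - lambda) * (rho - p) / (1 - p).

Lemma balance_pointP (p : R) : p < rho ->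
  lambda <= balance_point p <= M /\
  h * (balance_point p - lambda) = (b + h) * (rho - p) * (M - balance_point p).
Proof.
move=> pr; have /andP[rho0 rho1] := critical_ratio_itv b0 h0.
have p1 : 0 < 1 - p by rewrite subr_gt0 (lt_trans pr).
have bh0 : 0 < b + h by exact: addr_gt0.
split; last first.
  have hE : h = (b + h) * (1 - rho).
    by rewrite /critical_ratio; field; rewrite gt_eqF.
  rewrite {1}hE /balance_point; move: rho p1 => r p1; field.
  by rewrite gt_eqF.
have Ml : 0 < M - lambda by rewrite subr_gt0.
apply/andP; split.
  by rewrite lerDl ltW// divr_gt0// mulr_gt0// subr_gt0.
rewrite /balance_point -lerBrDl ler_pdivrMr// ler_pM2l//.
by rewrite lerD2r ltW.
Qed.

Lemma worst_case_unidentifiable :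
  ((h * (M - lambda) * Num.sqrt (1 - rho) * m * Num.min rho (3 * rho - 1)
    * expR (- 2^-1) / (64 * Num.sqrt N%:R))%:E
   <= worst_case_excess b h M lambda qpi
        (unidentifiable b h M lambda (m / 8) N))%E.
Proof.
have /andP[rho0 rho1] := critical_ratio_itv b0 h0.
have [m0 mr mr'] := min_ratio_itv; have [w0 w1 Nw] := inv_sqrt_itv.
have [/andP[s0 s1] /andP[e0 e1]] := shrink_factors.
have bh0 : 0 < b + h by exact: addr_gt0.
have hE : h = (b + h) * (1 - rho).
  by rewrite /critical_ratio; field; rewrite gt_eqF.
have mw0 : 0 < m * w by rewrite mulr_gt0.
have mw1 : m * w <= m by rewrite ler_piMr// ltW.
(* [p0] stays m / 2 away from rho, so the slope does not vanish as N grows; [p1] is O(1 / sqrt N)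
   from [p0] and still below the window, as m / 2 - m w / 4 > m w / 8. *)
pose p0 := rho - m / 2; pose p1 := p0 + m * w / 4.
have p0_ge : rho / 2 <= p0 by rewrite /p0; lra.
have p1_lt : p1 < rho - m / 8 * w by rewrite /p1 /p0; lra.
have p01 : p0 <= p1 by rewrite lerDl divr_ge0// ltW.
have q1 : 0 < 1 - p1 by lra.
have q0 : 0 < 1 - p0 by lra.
have memS p : p0 <= p <= p1 ->
    unidentifiable b h M lambda (m / 8) N (two_point p lambda).
  move=> /andP[pp0 pp1]; have p_01 : 0 <= p <= 1 by apply/andP; split; lra.
  split; first by apply: two_point_demand_class; rewrite ?l0//= ltW.
  rewrite cdf_left_two_point// l0 ltxx mulr1 mulr0 addr0.
  exact: le_lt_trans pp1 p1_lt.
have p0r : p0 < rho by lra.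
have p1r : p1 < rho by lra.
have [u0M bal0] := balance_pointP p0r; have [u1M bal1] := balance_pointP p1r.
have u01 : balance_point p0 - balance_point p1
    = (M - lambda) * (1 - rho) * (m * w / 4) / ((1 - p0) * (1 - p1)).
  rewrite /balance_point (_ : m * w / 4 = p1 - p0); last by rewrite /p1; ring.
  by field; rewrite !gt_eqF.
(* The targets are the two balance points, and the common slope is (b + h)(rho - p0). *)
have : (((b + h) * (m / 2) * (balance_point p0 - balance_point p1) / 4)%:E
    <= worst_case_excess b h M lambda qpi
         (unidentifiable b h M lambda (m / 8) N))%E.
  apply: (@worst_case_excess_ge _ b h M lambda p0 p1 lambda) => //.
  - by apply/andP; split; lra.
  - by apply/andP; split; lra.
  - rewrite (_ : N%:R * _ = N%:R * w ^+ 2 * (m ^+ 2 / 16)); last first.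
      by rewrite /p1; move: w => v; field.
    rewrite Nw mul1r; nra.
  - by rewrite mulr_ge0// ?divr_ge0// ltW.
  - rewrite -subr_ge0 u01 ltW// divr_gt0 ?mulr_gt0//.
    + by rewrite subr_gt0.
    + by rewrite subr_gt0.
  - by apply: memS; rewrite lexx.
  - by apply: memS; rewrite lexx andbT.
  - move=> q qM; rewrite (_ : m / 2 = rho - p0); last by rewrite /p0; ring.
    apply: excess_regret_ambiguous_below => //; rewrite ?bal0//; first exact: ltW.
    by apply/andP; split; lra.
  - move=> q qM.
    apply: le_trans (
      @excess_regret_ambiguous_above _ _ _ _ _ _ _ _ _ _ _ q _ qM u1M _) => //.
    (* The overage slope h = (b + h)(1 - rho) is at least (b + h)(m / 2), so it can be lowered to
       the common slope. *)
    + rewrite lee_fin ge_max !le_max lexx/=.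
      have [uq|uq] := leP (balance_point p1) q.
        rewrite ler_wpM2r ?orbT// ?subr_ge0// [leRHS]hE ler_wpM2l// ?ltW//.
        by lra.
      by rewrite mulr_ge0_le0 ?mulr_ge0 ?subr_le0 ?divr_ge0// ltW.
    + exact: ltW.
    + by apply/andP; split; lra.
    + by rewrite bal1.
apply: le_trans; rewrite lee_fin u01.
(* [v] may be negative, since 3 rho - 1 may be. The claim reduces to v (1 - p0)(1 - p1) <= 2 m. *)
pose v := Num.sqrt (1 - rho) * Num.min rho (3 * rho - 1) * expR (- 2^-1).
have v_le : v <= rho.
  have [g0|g0] := leP (Num.min rho (3 * rho - 1)) 0.
    by apply: le_trans (ltW rho0); rewrite mulr_le0_ge0// mulr_ge0_le0.
  apply: (@le_trans _ _ (Num.min rho (3 * rho - 1))); last by rewrite ge_min lexx.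
  rewrite /v mulrAC; apply: ler_piMl; first exact: ltW.
  by rewrite mulr_ile1.
have D0 : 0 < (1 - p0) * (1 - p1) by exact: mulr_gt0.
have vD : v * ((1 - p0) * (1 - p1)) <= 2 * m.
  have [v0|v0] := leP v 0.
    by apply: (@le_trans _ _ 0); [rewrite mulr_le0_ge0// ltW|rewrite mulr_ge0// ltW].
  have D1 : (1 - p0) * (1 - p1) <= 1 by nra.
  have D2 : (1 - p0) * (1 - p1) <= 9 / 4 * (1 - rho) ^+ 2.
    have -> : 9 / 4 * (1 - rho) ^+ 2 = 3 / 2 * (1 - rho) * (3 / 2 * (1 - rho)).
      by field.
    have p0E : p0 = rho - m / 2 by [].
    by apply: ler_pM; lra.
  (* If rho <= 1/2, then v <= rho = m and the product is at most 1. Otherwise v <= 1, m = 1 - rho,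
     and the product is at most (9/4)(1 - rho)^2 <= (9/8) m. *)
  have [half|half] := leP rho (1 - rho).
    have mE : m = rho by rewrite min_l.
    by apply: (@le_trans _ _ (rho * 1)); [apply: ler_pM; lra|lra].
  have mE : m = 1 - rho by rewrite min_r// ltW.
  apply: (@le_trans _ _ (1 * (9 / 4 * (1 - rho) ^+ 2))).
    by apply: ler_pM => //; lra.
  nra.
rewrite (_ : _ / (64 * _) = h * (M - lambda) * (m * w) / 64 * v); last first.
  by rewrite /v invfM; ring.
rewrite (_ : (b + h) * _ * _ / 4 = h * (M - lambda) * (m * w) / 64
  * (2 * m / ((1 - p0) * (1 - p1)))); last first.
  rewrite [X in _ = X * (M - lambda) * _ / 64 * _]hE.
  move: (1 - p0) (1 - p1) q0 q1 w => c0 c1 c0_gt0 c1_gt0 v'.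
  by field; rewrite !gt_eqF.
rewrite ler_wpM2l ?ler_pdivlMr//.
by rewrite mul0r ltW// !mulr_gt0// subr_gt0.
Qed.

End regimes.

Theorem theorem3 (R : realType) (b h lambda M : R)
    (hb : 0 < b) (hh : 0 < h) (hlambda : 0 < lambda) (hM : lambda < M) :
  let rho := critical_ratio b h in
  exists2 c : R, 0 < c &
    forall (N : nat) (qpi : N.-tuple R -> R), (0 < N)%N -> policy M qpi ->
    [/\ ((lambda * (b + h) * Num.sqrt (1 - rho) * Num.min rho (1 - rho)
           * expR (- 2^-1) / (64 * Num.sqrt N%:R))%:E
          <= worst_case_excess b h M lambda qpi
               (identifiable b h M lambda c N))%E,
        ((lambda * (b + h) * Num.sqrt (1 - rho) * Num.min rho (1 - rho)
           * expR (- 2^-1) / (32 * Num.sqrt N%:R))%:E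
          <= worst_case_excess b h M lambda qpi
               (knife_edge b h M lambda c N))%E
      & ((h * (M - lambda) * Num.sqrt (1 - rho) * Num.min rho (1 - rho)
           * Num.min rho (3 * rho - 1) * expR (- 2^-1)
           / (64 * Num.sqrt N%:R))%:E
          <= worst_case_excess b h M lambda qpi
               (unidentifiable b h M lambda c N))%E].
Proof.
(* One c serves all regimes: the half-width coefficient of the pair straddling rho. *)
move=> rho; exists (Num.min rho (1 - rho) / 8).
  by have [m0 _ _] := min_ratio_itv hb hh; rewrite divr_gt0.
move=> N qpi N0 qpiM; split.
- exact: worst_case_identifiable.
- exact: worst_case_knife_edge.
- exact: worst_case_unidentifiable.
Qed.
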